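(* Let $v\equiv 1$ or $3\pmod 6$, let $k$ be the largest integer such that $3^k$ divides $v$, and let $i\in\{0,\ldots,k\}$. Then the total number of different STS$(v)$ on $\{1,\ldots,v\}$ of $3$-rank $v-i-1$ equals $$\Gamma_{v,0,i}\sum_{j=i}^k \Gamma_{v,i,j}\,\mu^{(3)}_{j-i}\,\Phi_{v,j},$$ where $\mu^{(3)}_l=(-1)^l3^{\binom{l}{2}}$, $\Phi_{v,j}=\Psi_{v/3^j}^{\,3^j}\Lambda_{v/3^j}^{\,3^j(3^j-1)/6}$, $$\Gamma_{v,i,j}=\left(\left(\tfrac{v}{3^i}\right)!\right)^{3^i}\Bigg/\left(3^{\frac{(j+i+1)(j-i)}{2}}\left(\left(\tfrac{v}{3^j}\right)!\right)^{3^j}\prod_{s=1}^{j-i}(3^s-1)\right),$$ $\Psi_u$ is the number of STS$(u)$ on $\{1,\ldots,u\}$, and $\Lambda_u$ is the number of latin squares of order $u$.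
   Context: A Steiner triple system STS$(v)$ on $\{1,\ldots,v\}$ is a collection of 3-subsets (blocks) such that every 2-subset is contained in exactly one block; systems are different when their block sets differ. The $3$-rank of an STS is the dimension of the $\mathrm{GF}(3)$-linear span of the characteristic vectors of its blocks in $\mathrm{GF}(3)^v$. A latin square of order $u$ is a function $f:\{1,\ldots,u\}^2\to\{1,\ldots,u\}$ that is bijective in each argument. Conventions: $\Psi_1=1$, and $\Psi_u=0$ when no STS$(u)$ exists. *)

(* Defs.v *)
From HB Require Import structures.
From mathcomp Require Import all_boot all_order all_algebra.
Set Implicit Arguments. Unset Strict Implicit. Unset Printing Implicit Defensive.
Import GRing.Theory Num.Theory.

Definition is_STS (v : nat) (B : {set {set 'I_v}}) : bool :=
  [forall b in B, #|b| == 3] &&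
  [forall P : {set 'I_v}, (#|P| == 2) ==> (#|[set b in B | P \subset b]| == 1)].

Definition charvec (v : nat) (S : {set 'I_v}) : 'rV['F_3]_v :=
  \row_(x < v) (x \in S)%:R%R.

Definition rank3 (v : nat) (B : {set {set 'I_v}}) : nat :=
  \dim (span [seq charvec b | b <- enum B]).

Definition Psi (u : nat) : nat := #|[set B : {set {set 'I_u}} | is_STS B]|.

Definition is_latin (u : nat) (f : {ffun 'I_u * 'I_u -> 'I_u}) : bool :=
  [forall a, injectiveb (fun b => f (a, b))] &&
  [forall b, injectiveb (fun a => f (a, b))].

Definition Lambda (u : nat) : nat := #|[set f : {ffun 'I_u * 'I_u -> 'I_u} | is_latin f]|.

Local Open Scope ring_scope.

Definition mu3 (l : nat) : rat := (-1) ^+ l * 3%:R ^+ 'C(l, 2).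

Definition Phi (v j : nat) : rat :=
  (Psi (v %/ 3 ^ j))%:R ^+ (3 ^ j) *
  (Lambda (v %/ 3 ^ j))%:R ^+ ((3 ^ j * (3 ^ j - 1)) %/ 6)%N.

Definition Gamma (v i j : nat) : rat :=
  ((v %/ 3 ^ i)`!)%:R ^+ (3 ^ i) /
  (3%:R ^+ (((j + i + 1) * (j - i)) %/ 2)%N * ((v %/ 3 ^ j)`!)%:R ^+ (3 ^ j) *
   \prod_(1 <= s < (j - i).+1) ((3 ^ s)%:R - 1)).

(* Main.v *)
(* Let D(B) be the orthogonal over GF(3) of the blocks of an STS B on v points;
   it contains the all-one vector, and dim D(B) = m + 1 where rank = v - m - 1.
   A j-tuple of vectors of D(B) independent together with the all-one vector is
   a map from the points to V = GF(3)^j, summing to 0 on each block, whose image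
   affinely spans V.  The third-point operation of B makes such a map surjective
   with equal fibers, of size c = v / 3^j.  Conversely, once a balanced map to V
   is fixed, an STS compatible with it is the free choice of an STS(c) over each
   point of V and of a latin square of order c over each affine line of V.
   Counting pairs (B, map) both ways gives, for every j <= k, the sum over B of
     prod_(s < j) (3^(m+1) - 3^(s+1)),
   and this triangular system is inverted by the alternating q-binomial identity
   at q = 3. *)
Require Import Defs.
From HB Require Import structures.
From mathcomp Require Import all_boot all_order all_algebra.
From mathcomp Require Import finfield mxabelem ring zify.
Set Implicit Arguments. Unset Strict Implicit. Unset Printing Implicit Defensive.
Import GRing.Theory Num.Theory.
Local Open Scope ring_scope.

(** * Inversion of the triangular system *)

(** The 3-factorial without its normalisation by (3 - 1)^n; the quotient
    [qfact n / (qfact l * qfact (n - l))] is the Gaussian binomial coefficient at q = 3. *)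
Definition qfact (n : nat) : rat := \prod_(1 <= s < n.+1) ((3 ^ s)%:R - 1).

Lemma qfactS n : qfact n.+1 = qfact n * ((3 ^ n.+1)%:R - 1).
Proof. by rewrite /qfact big_nat_recr. Qed.

Lemma qfact_neq0 n : qfact n != 0.
Proof.
elim: n => [|n IHn]; first by rewrite /qfact big_geq // oner_eq0.
rewrite qfactS mulf_neq0 // subr_eq0 -[1]/(1%:R) eqr_nat.
by rewrite -(expn0 3) eqn_exp2l.
Qed.

(* Multiply by q^n - 1 = q^l (q^(n-l) - 1) + (q^l - 1) and telescope. *)
Lemma q_binomial_alternating n : (0 < n)%N ->
  \sum_(0 <= l < n.+1) mu3 l / (qfact l * qfact (n - l)) = 0.
Proof.
case: n => // n _.
have nz : (3 ^ n.+1)%:R - 1 != 0 :> rat.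
  by move: (qfact_neq0 n.+1); rewrite qfactS mulf_eq0 negb_or => /andP[].
apply: (mulfI nz); rewrite mulr0 mulr_sumr.
(* The two halves of term l are [w l] and [- w (l - 1)]. The first is cut off at l = n + 1, where
   its factor 3^0 - 1 vanishes but the truncated [n - l] would not show it; the second is set to 0
   at l = 0. *)
pose w l : rat := (-1) ^+ l * 3%:R ^+ 'C(l.+1, 2) / (qfact l * qfact (n - l)).
pose u l : rat := if (l <= n)%N then w l else 0.
pose d l : rat := if l is l'.+1 then - w l' else 0.
rewrite (eq_big_nat _ _ (F2 := fun l => u l + d l)).
  rewrite big_split /= big_nat_recr //= {2}/u ltnn addr0.
  rewrite [X in _ + X]big_nat_recl //= add0r -big_split /=.
  by apply: big1_seq => l /andP[_]; rewrite mem_index_iota /u => /andP[_ /ltnSE ->]; rewrite subrr.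
move=> l /andP[_ /ltnSE ln].
have E : (3 ^ n.+1)%:R - 1 = 3%:R ^+ l * ((3 ^ (n.+1 - l))%:R - 1) + ((3 ^ l)%:R - 1) :> rat.
  by rewrite !natrX mulrBr -exprD subnKC // mulr1 addrA subrK.
rewrite E mulrDl; congr (_ + _).
  rewrite /u; case: leqP => ln'; last first.
    have -> : l = n.+1 by lia.
    by rewrite subnn expn0 subrr mulr0 mul0r.
  rewrite subSn // qfactS /w /mu3 binS bin1 exprD.
  have := qfact_neq0 l; have := qfact_neq0 (n - l).
  have : (3 ^ (n - l).+1)%:R - 1 != 0 :> rat.
    by move: (qfact_neq0 (n - l).+1); rewrite qfactS mulf_eq0 negb_or => /andP[].
  by move=> ? ? ?; field; do ?[apply/andP; split].
case: l ln {E} => [|l] ln /=; first by rewrite expn0 subrr mul0r.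
rewrite /w /mu3 qfactS subSS exprS.
have := qfact_neq0 l; have := qfact_neq0 (n - l).
have : (3 ^ l.+1)%:R - 1 != 0 :> rat.
  by move: (qfact_neq0 l.+1); rewrite qfactS mulf_eq0 negb_or => /andP[].
by move=> ? ? ?; field; do ?[apply/andP; split].
Qed.

(* Number of ways to extend one nonzero vector of GF(3)^(m+1) to an independent
   family by a j-tuple; truncated subtraction makes it 0 for j > m. *)
Definition nb_ext (m j : nat) : nat := \prod_(s < j) (3 ^ m.+1 - 3 ^ (1 + s)).

Lemma nb_ext_gt m j : (m < j)%N -> nb_ext m j = 0%N.
Proof.
move=> mj; rewrite /nb_ext (bigD1 (Ordinal mj)) //=.
by rewrite add1n subnn mul0n.
Qed.

(** Factor s equals 3^(s+1) (3^(m-s) - 1): the powers of 3 collect to the exponent 1 + ... + j, and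
    the other factors are the top j factors of [qfact m]. *)
Lemma nb_extE m j : (j <= m)%N ->
  (nb_ext m j)%:R = 3%:R ^+ 'C(j.+1, 2) * qfact m / qfact (m - j).
Proof.
elim: j => [|j IHj] jm.
  by rewrite /nb_ext big_ord0 subn0 mul1r divff // qfact_neq0.
rewrite /nb_ext big_ord_recr /= natrM -/(nb_ext m j) IHj ?(ltnW jm) //.
rewrite -(subnSK jm) qfactS subnSK // (binS j.+1 1) bin1 exprD.
have -> : (3 ^ m.+1 - 3 ^ (1 + j))%:R = 3%:R ^+ j.+1 * ((3 ^ (m - j))%:R - 1) :> rat.
  rewrite natrB ?leq_exp2l ?(leqW jm) // !natrX mulrBr mulr1 -exprD; congr (_ ^+ _ - _).
  by lia.
have := qfact_neq0 m; have := qfact_neq0 (m - j.+1).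
have : (3 ^ (m - j))%:R - 1 != 0 :> rat.
  by move: (qfact_neq0 (m - j)); rewrite -(subnSK jm) qfactS mulf_eq0 negb_or => /andP[].
by move=> ? ? ?; field; do ?[apply/andP; split].
Qed.

(** This is [mu3 (j - i)] times the Gaussian binomial of j over i, divided by [nb_ext j j]: the
    inverse of the triangular matrix [nb_ext]. *)
Definition inv_coef (i j : nat) : rat :=
  mu3 (j - i) / (3%:R ^+ 'C(j.+1, 2) * qfact i * qfact (j - i)).

(** Only i <= j <= m contributes. There the power of 3 cancels, and with l = j - i what remains is
    [qfact m / qfact i] times the alternating sum for m - i, which survives only when m = i. *)
Lemma inv_coef_nb_ext i m k : (m <= k)%N -> (i <= k)%N ->
  \sum_(i <= j < k.+1) inv_coef i j * (nb_ext m j)%:R = (m == i)%:R.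
Proof.
move=> mk ik; have [mi | im] := ltnP m i.
  rewrite ltn_eqF // big1_seq // => j /andP[_].
  rewrite mem_index_iota => /andP[ij _].
  by rewrite nb_ext_gt ?mulr0 // (leq_trans mi).
rewrite (big_cat_nat (n := m.+1)) //=; last by rewrite leqW.
rewrite [X in _ + X]big1_seq ?addr0; last first.
  move=> j /andP[_]; rewrite mem_index_iota => /andP[mj _].
  by rewrite nb_ext_gt ?mulr0.
rewrite -{1}[i]add0n big_addn.
rewrite (eq_big_nat _ _ (F2 := fun l => qfact m / qfact i *
  (mu3 l / (qfact l * qfact (m - i - l))))); last first.
  move=> l /andP[_ lm]; rewrite nb_extE; last by lia.
  rewrite /inv_coef addnK -subnDA [(i + l)%N]addnC.
  have := qfact_neq0 l; have := qfact_neq0 (m - (l + i)); have := qfact_neq0 i.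
  by move=> ? ? ?; field; do ?[apply/andP; split]; rewrite ?expf_neq0.
rewrite -mulr_sumr subSn //.
have [-> | mi] := eqVneq m i; last by rewrite q_binomial_alternating ?mulr0 // subn_gt0 ltn_neqAle eq_sym mi.
rewrite subnn big_nat1 /mu3 /= !mulr1 -[qfact 0]/(qfact 0).
by rewrite divff ?qfact_neq0 // /qfact [in X in _ / X]big_geq // invr1 !mul1r mulr1.
Qed.

(** The power of (v / 3^i)! cancels between the two [Gamma] factors. The exponents i (i + 1) / 2 and
    (j + i + 1) (j - i) / 2 add up to j (j + 1) / 2; the integer halves add because i (i + 1) is
    even. *)
Lemma inv_coefE v i j : (i <= j)%N ->
  Gamma v 0 i * Gamma v i j * mu3 (j - i) =
  inv_coef i j * ((v`!)%:R / ((v %/ 3 ^ j)`!)%:R ^+ (3 ^ j)).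
Proof.
move=> ij; rewrite /Gamma /inv_coef !expn0 !divn1 expr1 !subn0 -!/(qfact _).
have f0 n : (n`!)%:R != 0 :> rat by rewrite pnatr_eq0 -lt0n fact_gt0.
have -> : 'C(j.+1, 2) = (((0 + i).+1 * i)  %/ 2 + ((j + i + 1) * (j - i)) %/ 2)%N.
  rewrite bin2 /= -divn2 add0n.
  have -> : (j.+1 * j = i.+1 * i + (j + i + 1) * (j - i))%N by nia.
  rewrite divnDl // dvdn2 oddM /=; by case: (odd i).
rewrite exprD addn0 addn1.
have := qfact_neq0 i; have := qfact_neq0 (j - i).
have := expf_neq0 (3 ^ i) (f0 (v %/ 3 ^ i)%N).
have := expf_neq0 (3 ^ j) (f0 (v %/ 3 ^ j)%N).
by move=> ? ? ? ?; field; do ?[apply/andP; split]; rewrite ?expf_neq0.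
Qed.

(** * Counting independent extensions *)

Lemma mxrank_adds_row (F : fieldType) N n (A : 'M[F]_(n, N)) (y : 'rV_N) :
  \rank (A + y)%MS = (\rank A + ~~ (y <= A)%MS)%N.
Proof.
have [yA | yA] := boolP (y <= A)%MS.
  by rewrite addn0; apply/eqmx_rank/eqmxP/addsmx_idPl.
apply/eqP; rewrite eqn_leq; apply/andP; split.
  by apply: leq_trans (mxrank_adds_leqif _ _) _; rewrite leq_add2l rank_leq_row.
rewrite addn1; apply: rank_ltmx.
by rewrite ltmxE addsmxSl addsmx_sub submx_refl.
Qed.

(** Rows are chosen one at a time: new row s must lie in D but outside the span of A and the earlier
    rows, of dimension [\rank A + s]. The induction absorbs the first row into A. *)
Lemma card_row_extensions (F : finFieldType) N d n j (D : 'M[F]_(d, N)) (A : 'M[F]_(n, N)) :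
  (A <= D)%MS ->
  #|[set Y : 'M[F]_(j, N) | (Y <= D)%MS && (\rank (A + Y)%MS == \rank A + j)%N]|
  = (\prod_(s < j) (#|F| ^ \rank D - #|F| ^ (\rank A + s)))%N.
Proof.
elim: j n A => [|j IHj] n A AD.
  rewrite big_ord0 -(cards1 (0 : 'M[F]_(0, N))); apply: eq_card => Y.
  by rewrite !inE [Y]flatmx0 sub0mx addsmx0 addn0 !eqxx.
rewrite big_ord_recl addn0 /=.
pose P (Y : 'M[F]_(1 + j, N)) := (Y <= D)%MS && (\rank (A + Y)%MS == \rank A + j.+1)%N.
pose Q (y : 'rV[F]_N) := (y <= D)%MS && ~~ (y <= A)%MS.
have PE (y : 'rV[F]_N) (Y : 'M[F]_(j, N)) : P (col_mx y Y) =
    Q y && ((Y <= D)%MS && (\rank ((A + y) + Y)%MS == \rank (A + y)%MS + j)%N).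
  rewrite /P /Q col_mx_sub.
  have -> : \rank (A + col_mx y Y)%MS = \rank (A + (y + Y))%MS.
    by apply/eqmx_rank/eqmxP/adds_eqmx => //; apply/eqmx_sym/addsmxE.
  have -> : \rank (A + (y + Y))%MS = \rank (A + y + Y)%MS by rewrite addsmxA.
  case: (y <= D)%MS => //=; case: (Y <= D)%MS; rewrite ?andbF //= ?andbT.
  have le1 : (\rank (A + y + Y)%MS <= \rank (A + y)%MS + j)%N.
    by apply: leq_trans (mxrank_adds_leqif _ _) _; rewrite leq_add2l rank_leq_row.
  (* A first row already in A caps the rank at [\rank A + j], one short of what [P] asks. *)
  rewrite mxrank_adds_row in le1 *; case: (y <= A)%MS le1 => /= le1; last by rewrite addn1 addSnnS.
  by apply/negbTE; rewrite neq_ltn; apply/orP; left; lia.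
rewrite -sum1_card (eq_bigl P) => [|Y]; last by rewrite inE.
rewrite (reindex (fun p : 'rV[F]_N * 'M[F]_(j, N) => col_mx p.1 p.2)); last first.
  exists (fun Y => (usubmx Y, dsubmx Y)) => [[y Y] _|Y _] /=.
    by rewrite col_mxKu col_mxKd.
  by rewrite vsubmxK.
rewrite (eq_bigl (fun p => Q p.1 && ((p.2 <= D)%MS &&
   (\rank ((A + p.1) + p.2)%MS == \rank (A + p.1)%MS + j)%N))); last by move=> p; rewrite PE.
rewrite -(pair_big_dep Q (fun y Y => (Y <= D)%MS && (\rank ((A + y) + Y)%MS == \rank (A + y)%MS + j)%N)
   (fun _ _ => 1%N)) /=.
rewrite (eq_bigr (fun=> \prod_(s < j) (#|F| ^ \rank D - #|F| ^ (\rank A + lift ord0 s)))%N).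
  rewrite sum_nat_const; congr (_ * _)%N.
  rewrite -!card_rowg -cardsDS.
    by apply: eq_card => y; rewrite in_setD !mem_rowg andbC.
  by rewrite rowgS.
move=> y /andP[yD yA].
rewrite sum1dep_card IHj ?addsmx_sub ?AD // mxrank_adds_row yA addn1.
by apply: eq_bigr => s _; rewrite addSnnS.
Qed.

(** * Compatible maps from a Steiner triple system *)

Definition pair_unique (T : finType) (B : {set {set T}}) (x y : T) : bool :=
  #|[set b in B | (x \in b) && (y \in b)]| == 1%N.

(** Relative to a subset S, so that systems on a fiber stay in the ambient type. *)
Definition sts_on (T : finType) (S : {set T}) (B : {set {set T}}) : bool :=
  [forall b in B, (#|b| == 3) && (b \subset S)] &&
  [forall x in S, forall y in S, (x != y) ==> pair_unique B x y].

Definition hom_sts (T : finType) (V : zmodType) (f : T -> V) (B : {set {set T}}) : bool :=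
  [forall b in B, \sum_(x in b) f x == 0].

Definition balanced (T V : finType) (c : nat) (f : T -> V) : bool :=
  [forall p, #|[set x | f x == p]| == c].

Lemma cards3P (T : finType) (A : {set T}) :
  reflect (exists x y z, [/\ x != y, x != z, y != z & A = [set x; y; z]]) (#|A| == 3).
Proof.
apply: (iffP idP) => [/eqP A3|[x [y [z [xy xz yz ->]]]]]; last first.
  by rewrite setUC cardsU1 cards2 xy !inE negb_or ![z == _]eq_sym xz yz.
have /card_gt0P[x xA] : (0 < #|A|)%N by rewrite A3.
have : #|A :\ x| == 2 by move: A3; rewrite (cardsD1 x) xA add1n => -[->].
move=> /cards2P[y [z [yz E]]].
have : y \in A :\ x by rewrite E !inE eqxx.
have : z \in A :\ x by rewrite E !inE eqxx orbT.
rewrite !inE => /andP[zx _] /andP[yx _].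
exists x, y, z; split => //; rewrite 1?eq_sym //.
by rewrite -(setD1K xA) E setUA.
Qed.

Lemma card3_third (T : finType) (b : {set T}) x y : #|b| == 3 ->
  x != y -> x \in b -> y \in b ->
  exists z, [/\ z != x, z != y & b = [set x; y; z]].
Proof.
move=> b3 xy xb yb; have : #|b :\ x :\ y| == 1%N.
  move: b3; rewrite (cardsD1 x) xb (cardsD1 y) !inE [y == x]eq_sym xy yb.
  by rewrite !add1n !eqSS.
case/cards1P => z E.
have : z \in b :\ x :\ y by rewrite E inE.
rewrite !inE => /and3P[zy zx zb]; exists z; split => //.
by rewrite -(setD1K xb) -(setD1K (_ : y \in b :\ x)) ?E ?setUA // !inE eq_sym xy yb.
Qed.

Lemma card_bij (T T' : finType) (A : {pred T}) (A' : {pred T'}) (g : T -> T') (h : T' -> T) :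
  {in A, forall x, g x \in A'} -> {in A', forall y, h y \in A} ->
  {in A, cancel g h} -> {in A', cancel h g} -> #|A| = #|A'|.
Proof.
move=> gA hA gK hK; apply/eqP; rewrite eqn_leq; apply/andP; split.
  rewrite -(card_in_image (can_in_inj gK)); apply/subset_leq_card/subsetP.
  by move=> _ /imageP[x xA ->]; apply: gA.
rewrite -(card_in_image (can_in_inj hK)); apply/subset_leq_card/subsetP.
by move=> _ /imageP[x xA ->]; apply: hA.
Qed.

Lemma big_set3 (T : finType) (V : zmodType) (f : T -> V) x y z :
  x != y -> x != z -> y != z -> \sum_(t in [set x; y; z]) f t = f x + f y + f z.
Proof.
move=> xy xz yz; rewrite setUC big_setU1 ?inE ?negb_or ?[z == _]eq_sym ?xz //=.
by rewrite big_setU1 ?inE // big_set1 addrC.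
Qed.

Lemma pair_uniqueP (T : finType) (B : {set {set T}}) x y :
  reflect (exists b, [/\ b \in B, x \in b, y \in b &
     forall b', b' \in B -> x \in b' -> y \in b' -> b' = b]) (pair_unique B x y).
Proof.
apply: (iffP cards1P) => [[b E]|[b [bB xb yb U]]].
  have : b \in [set b] by rewrite inE.
  rewrite -E inE => /and3P[bB xb yb]; exists b; split=> // b' b'B xb' yb'.
  by apply/set1P; rewrite -E inE b'B xb' yb'.
exists b; apply/setP => b'; rewrite !inE; apply/and3P/eqP => [[]|->] //.
exact: U.
Qed.

Lemma is_STSE v (B : {set {set 'I_v}}) : is_STS B = sts_on setT B.
Proof.
rewrite /is_STS /sts_on; congr (_ && _).
  by apply: eq_forallb => b; rewrite subsetT andbT.
apply/forallP/forall_inP => [H x _|H P].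
  apply/forall_inP => y _; apply/implyP => xy.
  have := H [set x; y]; rewrite cards2 xy /= => /eqP E; apply/eqP; rewrite -[RHS]E.
  by apply: eq_card => b; rewrite !inE subUset !sub1set.
apply/implyP => /cards2P[x [y [xy ->]]].
have /forall_inP/(_ y (in_setT _)) := H x (in_setT _); rewrite xy /= => /eqP E.
apply/eqP; rewrite -[RHS]E.
by apply: eq_card => b; rewrite !inE subUset !sub1set.
Qed.

Section Sts.
Variables (T : finType) (B : {set {set T}}).
Hypothesis stsB : sts_on setT B.

Lemma sts_card b : b \in B -> #|b| == 3.
Proof. by case/andP: stsB => /forall_inP H _ /H /andP[]. Qed.

Lemma sts_pair x y : x != y -> pair_unique B x y.
Proof.
case/andP: stsB => _ /forall_inP/(_ x (in_setT _))/forall_inP/(_ y (in_setT _)).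
by move/implyP.
Qed.

Lemma sts_inj b b' x y : x != y -> b \in B -> b' \in B ->
  x \in b -> y \in b -> x \in b' -> y \in b' -> b = b'.
Proof.
move=> /sts_pair/pair_uniqueP[b0 [_ _ _ U]] bB b'B xb yb xb' yb'.
by rewrite (U b) // (U b').
Qed.

Lemma sts_third x y : x != y -> exists z, [/\ z != x, z != y & [set x; y; z] \in B].
Proof.
move=> xy; have /pair_uniqueP[b [bB xb yb _]] := sts_pair xy.
have [z [zx zy E]] := card3_third (sts_card bB) xy xb yb.
by exists z; rewrite -E.
Qed.

Variables (V : finZmodType) (f : T -> V).
Hypothesis V3 : forall p : V, p *+ 3 = 0.
Hypothesis homf : hom_sts f B.

Lemma hom_third x y z : z != x -> z != y -> x != y -> [set x; y; z] \in B ->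
  f z = - (f x + f y).
Proof.
move=> zx zy xy xyzB; have /forall_inP/(_ _ xyzB) := homf.
rewrite big_set3 1?[_ == z]eq_sym // => /eqP E.
by apply/eqP; rewrite eq_sym -subr_eq0 -opprD oppr_eq0 E.
Qed.

(* The third point of the block through x and a sends the fiber of p injectively
   into the fiber of q. *)
Lemma fiber_card_le p q a : p != q -> f a = - (p + q) ->
  (#|[set x | f x == p]| <= #|[set x | f x == q]|)%N.
Proof.
move=> pq fa.
(* Otherwise q = -2p = p. Hence [a] is outside the fiber of p, each x of that fiber has a third
   point with [a], and the default value in [g] is never taken there. *)
have rp : f a != p.
  apply: contra pq => /eqP fap; apply/eqP/(@addrI _ (p + p)).
  by rewrite -addrA -[LHS]/(p *+ 3) V3 -addrA -{1}fap fa addNr.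
pose P x z := [&& z != x, z != a & [set x; a; z] \in B].
pose g x := odflt a [pick z | P x z].
have gP x : f x = p -> P x (g x).
  move=> fx; have xa : x != a by apply: contraNneq rp => <-; rewrite fx.
  rewrite /g; case: pickP => [z //|/= H].
  have [z [zx za zB]] := sts_third xa.
  by have := H z; rewrite /P zx za zB.
rewrite -(card_in_imset (f := g)) => [|x y].
  apply/subset_leq_card/subsetP => _ /imsetP[x + ->]; rewrite !inE => /eqP fx.
  have /and3P[zx za zB] := gP x fx.
  rewrite (hom_third zx za _ zB); last by apply: contraNneq rp => <-; rewrite fx.
  by rewrite fx fa opprD opprK addKr.
rewrite !inE => /eqP fx /eqP fy E.
have /and3P[zx za zB] := gP x fx.
have /and3P[zy _ zB'] := gP y fy.
rewrite -E in zy zB'.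
(* Both blocks contain [a] and [g x], so they coincide; x is neither of these two points, hence it
   is y. *)
have EB : [set x; a; g x] = [set y; a; g x].
  by apply: (sts_inj za) zB zB' _ _ _ _; rewrite !inE eqxx ?orbT.
have : x \in [set y; a; g x] by rewrite -EB !inE eqxx.
rewrite !inE [x == g x]eq_sym (negPf zx) orbF => /orP[/eqP //|/eqP xa].
by move: rp; rewrite -xa fx eqxx.
Qed.

(** For distinct p and q, surjectivity provides a point over -(p + q), and the third-point injection
    works in both directions, so all fibers have the same size. *)
Lemma hom_surj_balanced : (forall p, exists x, f x = p) ->
  balanced (#|T| %/ #|V|) f /\ (#|V| %| #|T|)%N.
Proof.
move=> surj.
have E p q : #|[set x | f x == p]| = #|[set x | f x == q]|.
  have [-> //|pq] := eqVneq p q.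
  have [a fa] := surj (- (p + q)).
  apply/eqP; rewrite eqn_leq (fiber_card_le pq fa) /=.
  by apply: (@fiber_card_le _ _ a); rewrite 1?eq_sym // addrC.
have cT : #|T| = (#|V| * #|[set x | f x == 0%R]|)%N.
  rewrite -[LHS]sum1_card (partition_big f xpredT) //= -sum_nat_const.
  by apply: eq_big => [p|p _]; rewrite ?inE // sum1dep_card (E 0 p).
rewrite cT dvdn_mulr // mulKn //; last by apply/card_gt0P; exists 0.
by split => //; apply/forallP => p; rewrite (E p 0).
Qed.

End Sts.

(** * Rank and the orthogonal of the blocks *)

Definition incmx v (B : {set {set 'I_v}}) : 'M['F_3]_(#|B|, v) :=
  \matrix_(i < #|B|) charvec (enum_val i).

Lemma rank3E v (B : {set {set 'I_v}}) : rank3 B = \rank (incmx B).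
Proof.
(* Both dimensions are exponents of 3 in the size of a set of vectors, so it suffices to compare the
   span and the row space as sets. *)
apply: (@expnI #|('F_3 : finFieldType)|); first by rewrite card_Fp.
rewrite -[RHS]card_rowg -[LHS](@card_vspace _ _ (Vector.class 'rV['F_3]_v)); apply: eq_card => x.
rewrite mem_rowg; apply/idP/idP => [xB|/submxP[u ->]].
  rewrite (coord_span (X := in_tuple _) xB); apply: summx_sub => i _.
  apply: scalemx_sub.
  have : (in_tuple [seq charvec b | b <- enum B])`_i \in [seq charvec b | b <- enum B].
    exact: mem_nth.
  case/mapP => b; rewrite mem_enum => bB ->.
  by rewrite -(enum_rankK_in bB bB) -[charvec _](rowK (fun i => charvec (enum_val i))) row_sub.
rewrite mulmx_sum_row; apply: memv_suml => i _; apply: memvZ; rewrite rowK.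
by apply: memv_span; apply: map_f; rewrite mem_enum enum_valP.
Qed.

Definition dualmx v (B : {set {set 'I_v}}) : 'M['F_3]_v := kermx (incmx B)^T.

(** Multiplying Y by the characteristic vector of b adds up the columns indexed by b; thus j vectors
    of the dual, as rows, amount to one compatible map to GF(3)^j, read off the columns. *)
Lemma sub_dualmx v (B : {set {set 'I_v}}) j (Y : 'M_(j, v)) :
  (Y <= dualmx B)%MS = hom_sts (fun x => col x Y) B.
Proof.
have E b : Y *m (charvec b)^T = \sum_(x in b) col x Y.
  apply/matrixP => i k; rewrite !mxE summxE [RHS]big_mkcond /=.
  apply: eq_bigr => x _; rewrite !mxE.
  by case: (x \in b); rewrite ?mulr1 ?mulr0.
apply/sub_kermxP/forall_inP => [YB b bB|H].
  rewrite -E -(enum_rankK_in bB bB) -[charvec _](rowK (fun i => charvec (enum_val i))).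
  by rewrite tr_row colE -/(incmx B) mulmxA YB mul0mx.
apply/matrixP => i k.
have /eqP := H _ (enum_valP k); rewrite -E => /matrixP/(_ i 0).
by rewrite !mxE => H0; rewrite -[RHS]H0; apply: eq_bigr => x _; rewrite !mxE.
Qed.

Lemma rank_dualmx v (B : {set {set 'I_v}}) : \rank (dualmx B) = (v - rank3 B)%N.
Proof. by rewrite mxrank_ker mxrank_tr rank3E. Qed.

Lemma natr3_F3 : 3%:R = 0 :> 'F_3. Proof. exact/eqP. Qed.

Lemma mulr3n_F3 m n (A : 'M['F_3]_(m, n)) : A *+ 3 = 0.
Proof. by rewrite -scaler_nat natr3_F3 scale0r. Qed.

Lemma sub_const_dualmx v (B : {set {set 'I_v}}) : sts_on setT B ->
  ((const_mx 1 : 'rV_v) <= dualmx B)%MS.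
Proof.
move=> stsB; rewrite sub_dualmx; apply/forall_inP => b bB.
rewrite (eq_bigr (fun=> const_mx 1)) => [|x _]; last by apply/matrixP => ? ?; rewrite !mxE.
by rewrite sumr_const (eqP (sts_card stsB bB)) mulr3n_F3.
Qed.

Lemma rank_const1 v : (0 < v)%N -> \rank (const_mx 1 : 'rV['F_3]_v) = 1%N.
Proof.
case: v => // v _; apply/eqP; rewrite eqn_leq rank_leq_row lt0n mxrank_eq0.
by apply/eqP => /matrixP/(_ 0 0)/eqP; rewrite !mxE oner_eq0.
Qed.

Lemma rank3_lt v (B : {set {set 'I_v}}) : (0 < v)%N -> sts_on setT B -> (rank3 B < v)%N.
Proof.
move=> v0 /sub_const_dualmx/mxrankS; rewrite rank_const1 // rank_dualmx.
by rewrite subn_gt0.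
Qed.

Definition spanning v j (Y : 'M['F_3]_(j, v)) : bool :=
  \rank ((const_mx 1 : 'rV_v) + Y)%MS == j.+1.

Lemma card_hom_spanning v (B : {set {set 'I_v}}) j : (0 < v)%N -> sts_on setT B ->
  #|[set Y : 'M_(j, v) | hom_sts (fun x => col x Y) B && spanning Y]|
  = nb_ext (v - rank3 B - 1) j.
Proof.
move=> v0 stsB.
have := card_row_extensions j (sub_const_dualmx stsB).
rewrite rank_const1 // rank_dualmx card_Fp // => E.
rewrite /nb_ext subn1 prednK ?subn_gt0 ?rank3_lt // -[RHS]E.
by apply: eq_card => Y; rewrite !inE sub_dualmx.
Qed.

(** A row (a, h) in the left kernel of the stacked matrix is an affine form a + h p vanishing at
    every column of Y; independence leaves only the zero form, so the columns affinely span. *)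
Lemma spanningP v j (Y : 'M['F_3]_(j, v)) :
  reflect (forall (a : 'F_3) (h : 'rV_j), const_mx a + h *m Y = 0 -> a = 0 /\ h = 0)
    (spanning Y).
Proof.
have -> : spanning Y = row_free (col_mx (const_mx 1 : 'rV_v) Y).
  by rewrite /row_free /spanning; congr (_ == _); apply/eqmx_rank/eqmxP/addsmxE.
have E (u : 'rV_(1 + j)) : u *m col_mx (const_mx 1) Y = const_mx (u 0 (lshift j 0)) + rsubmx u *m Y.
  rewrite -{1}[u]hsubmxK mul_row_col; congr (_ + _).
  by apply/matrixP => i k; rewrite !mxE big_ord1 !mxE mulr1 (ord1 i).
apply: (iffP idP) => [/row_free_inj inj a h H|H].
  have : row_mx (a%:M : 'M_1) h = 0.
    apply: inj; rewrite mul0mx E -[RHS]H row_mxKr; congr (const_mx _ + _).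
    by rewrite row_mxEl mxE.
  rewrite -row_mx0 => /eq_row_mx[/matrixP/(_ 0 0) + ->].
  by rewrite !mxE.
rewrite -kermx_eq0; apply/rowV0P => u /sub_kermxP; rewrite E => /H[u0 ur].
rewrite -[u]hsubmxK ur; apply/matrixP => i k; rewrite !mxE.
case: splitP => k' _; rewrite !mxE //.
by rewrite (ord1 i) (ord1 k').
Qed.

(** The values, translated by [p0], form a GF(3)-subspace: the third point with [x0] gives
    negatives, and the third point of two others gives minus their sum. This subspace contains the
    translated columns, which span. *)
Lemma hom_spanning_surj v (B : {set {set 'I_v}}) j (Y : 'M_(j, v)) :
  (0 < v)%N -> sts_on setT B -> hom_sts (fun x => col x Y) B -> spanning Y ->
  forall p : 'cV_j, exists x, col x Y = p.
Proof.
move=> v0 stsB homY /spanningP spY p.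
pose x0 := Ordinal v0; pose p0 := col x0 Y.
pose W (w : 'cV_j) := exists x, col x Y = w + p0.
have third x y : exists z, col z Y = - (col x Y + col y Y).
  have [-> | xy] := eqVneq x y.
    exists y; apply/eqP; rewrite -addr_eq0 addrCA -mulr2n -mulrS.
    by rewrite mulr3n_F3.
  have [z [zx zy zB]] := sts_third stsB xy.
  by exists z; rewrite (hom_third homY zx zy xy zB).
have W0 : W 0 by exists x0; rewrite add0r.
have p3 : - (p0 + p0) = p0.
  by apply/eqP; rewrite eq_sym -addr_eq0 -mulr2n -mulrS mulr3n_F3.
have WN w : W w -> W (- w).
  case=> x xw; have [z zE] := third x x0; exists z.
  by rewrite zE xw -addrA opprD p3.
have WD w w' : W w -> W w' -> W (w + w').
  case=> x xw [x' xw']; rewrite -[w + w']opprK; apply: WN.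
  by have [z zE] := third x x'; exists z; rewrite zE xw xw' addrACA opprD p3.
have WZ (a : 'F_3) w : W w -> W (a *: w).
  move=> Ww; rewrite -[a]natr_Zp scaler_nat.
  by elim: (a : nat) => [|n IH]; rewrite ?mulr0n // mulrS; apply: WD.
pose N : 'M_(j, v) := Y - p0 *m const_mx 1.
have colN x : col x N = col x Y - p0.
  by apply/matrixP => i k; rewrite !mxE big_ord1 !mxE mulr1.
(* If h kills [N], then h Y is the constant h p0, so the affine form with coefficients -h p0 and h
   vanishes on all columns of Y. *)
have freeN : row_free N.
  rewrite -kermx_eq0; apply/rowV0P => h /sub_kermxP hN.
  apply: (proj2 (spY (- (h *m p0) 0 0) h _)).
  rewrite -[RHS]hN mulmxBr addrC; congr (_ + _).
  apply/matrixP => i k; rewrite mulmxA !mxE big_ord1 !mxE mulr1.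
  by rewrite (ord1 i).
have /submxP[u uE] : ((p - p0)^T <= N^T)%MS.
  by apply: submx_full; rewrite /row_full mxrank_tr.
have [x xE] : W (p - p0).
  have -> : p - p0 = \sum_x u 0 x *: col x N.
    rewrite -[LHS]trmxK uE mulmx_sum_row linear_sum; apply: eq_bigr => x _.
    by rewrite linearZ /= -tr_col trmxK.
  elim/big_ind: _ => // x _; apply: WZ.
  by exists x; rewrite colN subrK.
by exists x; rewrite xE subrK.
Qed.

(** With c > 0 every p is a column, so an affine form vanishing on the columns vanishes everywhere:
    evaluate it at 0, then at the unit vectors. *)
Lemma balanced_spanning v j (Y : 'M['F_3]_(j, v)) c :
  (0 < c)%N -> balanced c (fun x => col x Y) -> spanning Y.
Proof.
move=> c0 /forallP bal.
have surj (p : 'cV_j) : exists x, col x Y = p.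
  have /card_gt0P[x] : (0 < #|[set x | col x Y == p]|)%N by rewrite (eqP (bal p)).
  by rewrite inE => /eqP; exists x.
apply/spanningP => a h H.
have E (p : 'cV_j) : h *m p = const_mx (- a).
  have [x <-] := surj p; move/eqP: H; rewrite addrC addr_eq0 => /eqP HE.
  by rewrite colE mulmxA HE -colE; apply/matrixP => ? ?; rewrite !mxE.
have a0 : a = 0.
  have := E 0; rewrite mulmx0 => /matrixP/(_ 0 0); rewrite !mxE => /eqP.
  by rewrite eq_sym oppr_eq0 => /eqP.
split=> //; apply/matrixP => i k; rewrite (ord1 i).
have := E (delta_mx k 0); rewrite a0 oppr0 -colE => /matrixP/(_ 0 0).
by rewrite !mxE.
Qed.

Lemma hom_spanning_balanced v (B : {set {set 'I_v}}) j (Y : 'M_(j, v)) :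
  (0 < v)%N -> sts_on setT B -> hom_sts (fun x => col x Y) B ->
  spanning Y -> balanced (v %/ 3 ^ j) (fun x => col x Y) /\ (3 ^ j %| v)%N.
Proof.
move=> v0 stsB homY spY.
have := hom_surj_balanced stsB (@mulr3n_F3 j 1) homY (hom_spanning_surj v0 stsB homY spY).
by rewrite card_mx card_Fp // muln1 card_ord.
Qed.

(** * Counting balanced maps *)

(** Coordinates identifying T with V x 'I_c so that f becomes the first projection: [e p a] is point
    number a over p, and [r] is the second coordinate. *)
Lemma balanced_param (T V : finType) c (f : T -> V) : balanced c f ->
  exists2 e : V -> 'I_c -> T, (forall p, injective (e p)) /\ (forall p a, f (e p a) = p) &
    exists r : T -> 'I_c, forall x, e (f x) (r x) = x.
Proof.
move=> /forallP bal.
pose F p := [set x | f x == p].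
have cF p : c = #|F p| by rewrite (eqP (bal p)).
exists (fun p a => enum_val (cast_ord (cF p) a)).
  split=> [p a b /enum_val_inj/cast_ord_inj //|p a].
  by have := enum_valP (cast_ord (cF p) a); rewrite inE => /eqP.
have xF x : x \in F (f x) by rewrite inE.
exists (fun x => cast_ord (esym (cF _)) (enum_rank_in (xF x) x)) => x.
by rewrite cast_ordKV enum_rankK_in.
Qed.

(** Counts bijections from T to V x 'I_c: each projects to a balanced map, and those over a fixed
    balanced map differ by one permutation of 'I_c per point of V. *)
Lemma card_balanced (T V : finType) c : #|T| = (#|V| * c)%N ->
  (#|[set f : {ffun T -> V} | balanced c f]| * c`! ^ #|V| = #|T|`!)%N.
Proof.
move=> cT; pose H := [set h : {ffun T -> V * 'I_c} | injectiveb h].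
have cH : #|H| = (#|T|`!)%N.
  by rewrite card_inj_ffuns card_prod card_ord -cT ffactnn.
pose phi (h : {ffun T -> V * 'I_c}) : {ffun T -> V} := [ffun x => (h x).1].
have phib h : h \in H -> balanced c (phi h).
  rewrite inE => /injectiveP hI; apply/forallP => p.
  have [g hK gK] : bijective h by apply: inj_card_bij; rewrite // card_prod card_ord cT.
  have gI := can_inj gK.
  rewrite -[X in _ == X]card_ord -(card_imset (f := fun a => g (p, a))) => [|a b /gI [] //].
  apply/eqP/eq_card => x; rewrite inE ffunE; apply/eqP/imsetP => [hp|[a _ ->]].
    by exists (h x).2; rewrite // -hp -surjective_pairing hK.
  by rewrite gK.
rewrite -cH -[RHS]sum1_card (partition_big phi (fun f => balanced c f)) /=; last exact: phib.
rewrite -sum_nat_const big_mkcond [RHS]big_mkcond /=.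
apply: eq_bigr => f _; rewrite inE; case: ifP => // balf.
rewrite sum1dep_card.
have [e [eI fe] [r er]] := balanced_param balf.
have re p a : r (e p a) = a by apply: (eI p); rewrite -{1}[p](fe p a) er.
pose R := [set g : {ffun 'I_c -> 'I_c} | injectiveb g].
have <- : #|R| = (c`!)%N by rewrite card_inj_ffuns card_ord ffactnn.
rewrite -card_ffun_on.
pose g (k : {ffun V -> {ffun 'I_c -> 'I_c}}) : {ffun T -> V * 'I_c} :=
  [ffun x => (f x, k (f x) (r x))].
pose g' (h : {ffun T -> V * 'I_c}) : {ffun V -> {ffun 'I_c -> 'I_c}} :=
  [ffun p => [ffun a => (h (e p a)).2]].
apply: (card_bij (g := g) (h := g')).
- move=> k /ffun_onP kR; rewrite !inE; apply/andP; split.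
    apply/injectiveP => x y; rewrite !ffunE => -[fxy].
    have := kR (f y); rewrite inE fxy => /injectiveP kI /kI rxy.
    by rewrite -[x]er -[y]er fxy rxy.
  by apply/eqP/ffunP => x; rewrite !ffunE.
- move=> h; rewrite !inE => /andP[/injectiveP hI /eqP hf].
  apply/ffun_onP => p; rewrite inE; apply/injectiveP => a b; rewrite !ffunE => E.
  apply: (eI p); apply: hI; apply: injective_projections => //.
  have hfE x : (h x).1 = f x by rewrite -hf ffunE.
  by rewrite !hfE !fe.
- by move=> k _; apply/ffunP => p; apply/ffunP => a; rewrite !ffunE fe re.
move=> h; rewrite !inE => /andP[_ /eqP hf]; apply/ffunP => x.
by rewrite !ffunE er -[f x]/(fun_of_fin f x) -hf ffunE -surjective_pairing.
Qed.

(** * Factoring a compatible system over the flats *)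

(* A point when p = q, otherwise the affine line through p and q; both are then
   treated uniformly. *)
Definition flat (V : finZmodType) (p q : V) : {set V} := [set p; q; - (p + q)].

Definition flats (V : finZmodType) : {set {set V}} :=
  [set flat pq.1 pq.2 | pq : V * V].

Section Flats.
Variable V : finZmodType.
Hypothesis V3 : forall p : V, p *+ 3 = 0.

Lemma third_eql (p q : V) : (- (p + q) == p) = (p == q).
Proof.
have V3' : - p = p + p.
  by apply/eqP; rewrite eq_sym -addr_eq0 -addrA; apply/eqP/V3.
by rewrite opprD V3' -addrA -[X in _ == X]addr0 (inj_eq (addrI _)) subr_eq0.
Qed.

Lemma third_eqr (p q : V) : (- (p + q) == q) = (p == q).
Proof. by rewrite addrC third_eql eq_sym. Qed.

Lemma flatxx (p : V) : flat p p = [set p].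
Proof. by apply/setP => t; rewrite !inE (eqP (_ : - (p + p) == p)) ?orbb // third_eql. Qed.

Lemma card_flat (p q : V) : p != q -> #|flat p q| = 3.
Proof.
move=> pq; apply/eqP/cards3P; exists p, q, (- (p + q)).
by rewrite ![_ == - _]eq_sym third_eql third_eqr.
Qed.

Lemma flat_third (p q r : V) : p + q + r = 0 -> flat p q = [set p; q; r].
Proof. by move/eqP; rewrite addrC addr_eq0 => /eqP ->. Qed.

Lemma flat_mem (p q p' q' : V) : p' != q' -> p' \in flat p q -> q' \in flat p q ->
  flat p' q' = flat p q.
Proof.
have C (x y : V) : flat x y = flat y x by rewrite /flat [_ |: [set y]]setUC addrC.
have R (x y : V) : flat x (- (x + y)) = flat x y.
  have H : x + - (x + y) + y = 0 by rewrite opprD addrA subrr add0r addNr.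
  by rewrite (flat_third H) /flat setUAC.
have R' : flat q (- (p + q)) = flat p q by rewrite [p + q]addrC R C.
rewrite !inE => pq' /orP[/orP[]|] /eqP Ep /orP[/orP[]|] /eqP Eq; move: pq';
  by rewrite Ep Eq ?eqxx ?R ?R' // C ?R ?R'.
Qed.

Lemma card_point_flats : #|[set y in flats V | #|y| == 1%N]| = #|V|.
Proof.
rewrite -(card_imset _ (@set1_inj V)); apply: eq_card => y; rewrite !inE.
apply/andP/imsetP => [[_ /cards1P[p ->]]|[p _ ->]]; first by exists p.
rewrite cards1 eqxx -flatxx; split=> //.
by apply/imsetP; exists (p, p).
Qed.

(** Counts ordered pairs of distinct points: each lies on one line, and a line carries 9 - 3 = 6 of
    them. *)
Lemma card_line_flats : (#|[set y in flats V | #|y| != 1%N]| * 6 = #|V| * (#|V| - 1))%N.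
Proof.
set L := [set y in _ | _].
have <- : #|[set pq : V * V | pq.1 != pq.2]| = (#|V| * (#|V| - 1))%N.
  have -> : [set pq : V * V | pq.1 != pq.2] = ~: [set (p, p) | p : V].
    apply/setP => -[p q]; rewrite !inE; congr (~~ _).
    by apply/eqP/imsetP => /= [->|[x _ [-> ->]]] //; exists q.
  rewrite cardsCs setCK card_prod card_imset => [|x y [] //].
  by rewrite mulnBr muln1.
rewrite -sum_nat_const -[RHS]sum1_card.
rewrite (partition_big (fun pq => flat pq.1 pq.2) (fun y => y \in L)) /=; last first.
  move=> [p q]; rewrite !inE /= => pq; rewrite card_flat // andbT.
  by apply/imsetP; exists (p, q).
apply: eq_bigr => y; rewrite !inE => /andP[/imsetP[[p q] _ /= ->]].
have [->|pq _] := eqVneq p q; first by rewrite flatxx cards1.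
rewrite sum1dep_card.
pose S := flat p q.
have -> : [set x | (x \in [set pq : V * V | pq.1 != pq.2]) && (flat x.1 x.2 == flat p q)]
   = setX S S :\: [set (t, t) | t in S].
  apply/setP => -[p' q']; rewrite in_setD in_setX 2!in_set /=.
  apply/andP/andP => [[pq' /eqP E]|[N /andP[Sp Sq]]].
    rewrite /S -E !inE !eqxx !orbT; split=> //.
    by apply: contra pq' => /imsetP[t _ [-> ->]].
  have pq' : p' != q' by apply: contra N => /eqP ->; apply/imsetP; exists q'.
  by rewrite (flat_mem pq' Sp Sq) eqxx.
rewrite cardsDS ?cardsX ?card_imset ?card_flat // => [a b [] //|].
by apply/subsetP => _ /imsetP[t tS ->]; rewrite in_setX /= tS.
Qed.

End Flats.

Section Blocks.
Variables (T : finType) (V : finZmodType) (f : T -> V).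
Hypothesis V3 : forall p : V, p *+ 3 = 0.

(** If the values sum to 0, the third is minus the sum of the others, as in a flat. Conversely, a
    one-point image gives 3p = 0, and an image of size 3 makes f injective on b, with sum p + q - (p
    + q). *)
Lemma block_sum0 (b : {set T}) : #|b| == 3 ->
  (\sum_(x in b) f x == 0) = (f @: b \in flats V).
Proof.
move=> b3; apply/eqP/imsetP => [|[[p q] _ /= E]].
  case/cards3P: b3 => x [y [z [xy xz yz ->]]]; rewrite big_set3 // => s0.
  by exists (f x, f y); rewrite //= (flat_third s0) !imsetU !imset_set1.
have [pq|pq] := eqVneq p q.
  rewrite (eq_bigr (fun=> p)) ?sumr_const ?(eqP b3) ?V3 // => x xb.
  have : f x \in f @: b by apply: imset_f.
  by rewrite E pq flatxx // inE => /eqP.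
have : {in b &, injective f}.
  by apply/imset_injP; rewrite E card_flat // (eqP b3).
move=> fI; rewrite -(big_imset (fun t => t) fI) /= E /flat.
have [] : [/\ p != q, p != - (p + q) & q != - (p + q)].
  by rewrite ![_ == - _]eq_sym third_eql ?third_eqr.
by move=> *; rewrite big_set3 // addrN.
Qed.

Lemma block_flat (b : {set T}) x y : #|b| == 3 -> f @: b \in flats V ->
  x != y -> x \in b -> y \in b -> f @: b = flat (f x) (f y).
Proof.
move=> b3; rewrite -block_sum0 // => s0 xy xb yb.
have [z [zx zy bE]] := card3_third b3 xy xb yb.
move: s0; rewrite bE big_set3 1?[_ == z]eq_sym // => /eqP/flat_third ->.
by rewrite !imsetU !imset_set1.
Qed.

(* The blocks of a compatible system lying over the flat [y]; when [y] is not a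
   flat only the empty set qualifies. *)
Definition factor (y : {set V}) (A : {set {set T}}) : bool :=
  [forall b in A, [&& #|b| == 3, f @: b == y & y \in flats V]] &&
  [forall x1, forall x2, (x1 != x2) && (flat (f x1) (f x2) == y) ==> pair_unique A x1 x2].

Lemma factorP y (A : {set {set T}}) : reflect
  ((forall b, b \in A -> [/\ #|b| == 3, f @: b = y & y \in flats V]) /\
   (forall x1 x2, x1 != x2 -> flat (f x1) (f x2) = y -> pair_unique A x1 x2))
  (factor y A).
Proof.
apply: (iffP andP) => -[H1 H2]; split.
- by move=> b bA; move/forall_inP: H1 => /(_ b bA)/and3P[-> /eqP -> ->].
- move=> x1 x2 x12 E; move/forallP: H2 => /(_ x1)/forallP/(_ x2)/implyP; apply.
  by rewrite x12 E eqxx.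
- by apply/forall_inP => b /H1[-> -> ->]; rewrite eqxx.
apply/forallP => x1; apply/forallP => x2; apply/implyP => /andP[x12 /eqP].
exact: H2.
Qed.

(** A pair x1, x2 can only be covered by a block over the flat through f x1 and f x2. So the parts
    of a system over different flats obey independent conditions, and any family of parts glues to a
    system. *)
Lemma card_sts_hom_factor :
  #|[set B : {set {set T}} | sts_on setT B && hom_sts f B]|
  = (\prod_(y : {set V}) #|[set A | factor y A]|)%N.
Proof.
have -> : (\prod_(y : {set V}) #|[set A | factor y A]|)%N
  = #|(family (fun y => [set A | factor y A]) : {pred {ffun {set V} -> {set {set T}}}})|.
  by rewrite card_family foldrE big_image.
pose g (B : {set {set T}}) : {ffun {set V} -> {set {set T}}} :=
  [ffun y => [set b in B | f @: b == y]].
(* Gluing: a block is looked up in the part indexed by its own image. *)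
pose h (G : {ffun {set V} -> {set {set T}}}) : {set {set T}} :=
  [set b : {set T} | b \in G (f @: b)].
apply: (card_bij (g := g) (h := h)).
- move=> B; rewrite inE => /andP[stsB /forall_inP homB]; apply/familyP => y.
  have blk b : b \in B -> #|b| == 3 /\ f @: b \in flats V.
    move=> bB; have b3 := sts_card stsB bB.
    by rewrite -block_sum0 // homB.
  rewrite inE ffunE; apply/factorP; split=> [b|x1 x2 x12 E].
    by rewrite inE => /andP[/blk[b3 bf] /eqP <-].
  have /pair_uniqueP[b [bB xb1 xb2 U]] := sts_pair stsB x12.
  have [b3 bf] := blk b bB.
  apply/pair_uniqueP; exists b; split=> // [|b'].
    by rewrite inE bB (block_flat b3 bf x12) // E eqxx.
  by rewrite inE => /andP[/U].
- move=> G /familyP GF; rewrite inE.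
  have {}GF y : (forall b, b \in G y -> [/\ #|b| == 3, f @: b = y & y \in flats V]) /\
   (forall x1 x2, x1 != x2 -> flat (f x1) (f x2) = y -> pair_unique (G y) x1 x2).
    by apply/factorP; have := GF y; rewrite inE.
  apply/andP; split; last first.
    apply/forall_inP => b; rewrite inE => /(proj1 (GF _))[b3 _ bf].
    by rewrite block_sum0.
  apply/andP; split.
    by apply/forall_inP => b; rewrite inE subsetT andbT => /(proj1 (GF _))[].
  apply/forall_inP => x1 _; apply/forall_inP => x2 _; apply/implyP => x12.
  have /pair_uniqueP[b [bG xb1 xb2 U]] := proj2 (GF _) _ _ x12 erefl.
  apply/pair_uniqueP; exists b; split=> // [|b'].
    by rewrite inE; have [_ -> _] := proj1 (GF _) _ bG.
  rewrite inE => b'G xb1' xb2'; apply: U => //.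
  have [b3 _ bf] := proj1 (GF _) _ b'G.
  by rewrite -(block_flat b3 bf x12).
- move=> B _; apply/setP => b; rewrite !inE ffunE inE eqxx andbT //.
move=> G /familyP GF; apply/ffunP => y; rewrite ffunE; apply/setP => b; rewrite !inE.
apply/andP/idP => [[+ /eqP <-] //|bG].
have := GF y; rewrite inE => /factorP[/(_ b bG)[_ E _] _].
by rewrite E eqxx.
Qed.

Lemma card_factor_notin y : y \notin flats V -> #|[set A | factor y A]| = 1%N.
Proof.
move=> yF; apply/eqP/cards1P; exists set0; apply/setP => A; rewrite !inE.
apply/factorP/eqP => [[H _]|->].
  by apply/setP => b; rewrite inE; apply: contraNF yF => /H[].
split=> [b|x1 x2 _ E]; first by rewrite inE.
by case/negP: yF; rewrite -E; apply/imsetP; exists (f x1, f x2).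
Qed.

Lemma factor_point p A : factor [set p] A = sts_on [set x | f x == p] A.
Proof.
have E x1 x2 : (flat (f x1) (f x2) == [set p]) = (f x1 == p) && (f x2 == p).
  have [->|n] := eqVneq (f x1) (f x2).
    by rewrite flatxx // (inj_eq set1_inj) andbb.
  transitivity false.
    by apply/eqP => /(congr1 (fun A : {set V} => #|A|)); rewrite card_flat // cards1.
  by apply/esym/andP => -[/eqP E1 /eqP E2]; rewrite E1 E2 eqxx in n.
congr (_ && _).
  apply: eq_forallb => b; congr (_ ==> _); case: eqP => //= b3.
  have -> : [set p] \in flats V by apply/imsetP; exists (p, p); rewrite //= flatxx.
  rewrite andbT; apply/eqP/subsetP => [fb x xb|H].
    by rewrite inE -in_set1 -fb imset_f.
  have /card_gt0P[x0 x0b] : (0 < #|b|)%N by rewrite b3.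
  apply/setP => t; rewrite inE; apply/imsetP/eqP => [[x /H + ->]|->].
    by rewrite inE => /eqP.
  by exists x0; rewrite // (eqP (_ : f x0 == p)) //; have := H _ x0b; rewrite inE.
apply/forallP/forall_inP => [H x1|H x1].
  rewrite inE => fx1; apply/forall_inP => x2; rewrite inE => fx2.
  by apply/implyP => x12; have /forallP/(_ x2) := H x1; rewrite E x12 fx1 fx2.
apply/forallP => x2; rewrite E; apply/implyP => /and3P[x12 fx1 fx2].
have := H x1; rewrite inE fx1 => /(_ isT)/forall_inP/(_ x2).
by rewrite inE fx2 x12; apply.
Qed.

End Blocks.

(** * Factors over points and lines *)

(** Transport along [e]: a block inside the image of [e] is the image of its preimage. *)
Lemma card_sts_on (T : finType) c (e : 'I_c -> T) : injective e ->
  #|[set A | sts_on (e @: [set: 'I_c]) A]| = Psi c.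
Proof.
move=> eI; have eI' := imset_inj eI.
have pre (b : {set T}) : b \subset e @: [set: 'I_c] -> b = e @: (e @^-1: b).
  move=> /subsetP be; apply/setP => t.
  apply/idP/imsetP => [tb|[x + ->]]; last by rewrite inE.
  by have /imsetP[x _ tx] := be _ tb; exists x; rewrite // inE -tx.
rewrite /Psi; apply/esym.
apply: (card_bij (g := fun A : {set {set 'I_c}} => [set e @: b | b : {set 'I_c} in A])
   (h := fun A => [set b : {set 'I_c} | e @: b \in A])).
- move=> A; rewrite !inE is_STSE => stsA; apply/andP; split.
    apply/forall_inP => _ /imsetP[b bA ->].
    by rewrite card_imset // (sts_card stsA bA) imsetS ?subsetT.
  apply/forall_inP => _ /imsetP[x _ ->]; apply/forall_inP => _ /imsetP[y _ ->].
  apply/implyP; rewrite (inj_eq eI) => xy.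
  have /pair_uniqueP[b [bA xb yb U]] := sts_pair stsA xy.
  apply/pair_uniqueP; exists (e @: b); rewrite !mem_imset //; split=> //.
  by move=> _ /imsetP[b' b'A ->]; rewrite !mem_imset // => xb' yb'; rewrite (U b').
- move=> A; rewrite !inE is_STSE => /andP[/forall_inP H1 /forall_inP H2].
  apply/andP; split.
    apply/forall_inP => b; rewrite inE => /H1/andP[b3 _].
    by rewrite subsetT andbT -(card_imset _ eI).
  apply/forall_inP => x _; apply/forall_inP => y _; apply/implyP => xy.
  have /forall_inP/(_ (e y)) := H2 (e x) (imset_f _ (in_setT _)).
  rewrite imset_f // inj_eq // xy => /(_ isT)/pair_uniqueP[b [bA xb yb U]].
  have bE : b = e @: (e @^-1: b) by apply: pre; case/andP: (H1 b bA).
  apply/pair_uniqueP; exists (e @^-1: b); rewrite !inE -bE; split=> // b2.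
  rewrite inE => b2A xb2 yb2; apply: eI'; rewrite -bE; apply: U => //; exact: imset_f.
- by move=> A _; apply/setP => b; rewrite inE mem_imset.
move=> A; rewrite inE => /andP[/forall_inP H1 _]; apply/setP => b.
apply/imsetP/idP => [[b' + ->]|bA]; first by rewrite inE.
have /andP[_ /pre bE] := H1 b bA.
by exists (e @^-1: b); rewrite // inE -bE.
Qed.

Lemma pair_uniqueC (T : finType) (A : {set {set T}}) x y : pair_unique A x y = pair_unique A y x.
Proof.
by rewrite /pair_unique; congr (_ == _); apply: eq_card => b; rewrite !inE [(x \in b) && _]andbC.
Qed.

Section Line.
Variables (T : finType) (V : finZmodType) (f : T -> V) (c : nat) (e : V -> 'I_c -> T) (r : T -> 'I_c).
Hypothesis V3 : forall p : V, p *+ 3 = 0.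
Hypothesis eI : forall p, injective (e p).
Hypothesis fe : forall p a, f (e p a) = p.
Hypothesis er : forall x, e (f x) (r x) = x.

Variables p q : V.
Hypothesis pq : p != q.
Let s := - (p + q).

Let ps : p != s. Proof. by rewrite eq_sym third_eql. Qed.
Let qs : q != s. Proof. by rewrite eq_sym third_eqr. Qed.

(** A block over the line meets each of the fibers over p, q and s once; a, b and d are the
    coordinates of these three points. *)
Let tri a b d : {set T} := [set e p a; e q b; e s d].

Lemma e_eq u u' a b : (e u a == e u' b) = (u == u') && (a == b).
Proof.
apply/eqP/andP => [E|[/eqP -> /eqP -> //]].
have uu : u = u' by rewrite -(fe u a) E fe.
by split; apply/eqP => //; apply: (eI (p := u)); rewrite E uu.
Qed.

Let mem_p a a' b d : (e p a' \in tri a b d) = (a' == a).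
Proof. by rewrite !inE !e_eq eqxx (negPf pq) (negPf ps) !orbF. Qed.

Let mem_q a b b' d : (e q b' \in tri a b d) = (b' == b).
Proof. by rewrite !inE !e_eq eqxx [q == p]eq_sym (negPf pq) (negPf qs) /= orbF. Qed.

Let mem_s a b d d' : (e s d' \in tri a b d) = (d' == d).
Proof. by rewrite !inE !e_eq eqxx ![s == _]eq_sym (negPf ps) (negPf qs). Qed.

Let card_tri a b d : #|tri a b d| == 3.
Proof.
apply/cards3P; exists (e p a), (e q b), (e s d).
by rewrite !e_eq (negPf pq) (negPf ps) (negPf qs).
Qed.

Let f_tri a b d : f @: tri a b d = flat p q.
Proof. by rewrite !imsetU !imset_set1 !fe. Qed.

Let flat_in : flat p q \in flats V.
Proof. by apply/imsetP; exists (p, q). Qed.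

Let block_tri (b : {set T}) : #|b| == 3 -> f @: b = flat p q ->
  exists x y z, b = tri x y z.
Proof.
move=> b3 fb.
have H u : u \in flat p q -> exists x, e u x \in b.
  by rewrite -fb => /imsetP[t tb ->]; exists (r t); rewrite er.
have [|x xb] := H p; first by rewrite !inE eqxx.
have [|y yb] := H q; first by rewrite !inE eqxx orbT.
have [|z zb] := H s; first by rewrite !inE eqxx orbT.
exists x, y, z; apply/esym/eqP; rewrite eqEcard (eqP b3) (eqP (card_tri _ _ _)) andbT.
by rewrite !subUset !sub1set xb yb zb.
Qed.

(** If f x = f y, the flat would be a single point; so x and y lie over different points of the
    line, and three cases remain up to symmetry. *)
Let pair_cases (P : T -> T -> Prop) :
  (forall x y, P x y -> P y x) ->
  (forall a b, P (e p a) (e q b)) -> (forall a d, P (e p a) (e s d)) ->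
  (forall b d, P (e q b) (e s d)) ->
  forall x y, flat (f x) (f y) = flat p q -> P x y.
Proof.
move=> PC Ppq Pps Pqs x y E.
have fxy : f x != f y.
  apply/negP => /eqP fxy; move: E; rewrite fxy flatxx // => /(congr1 (fun A : {set V} => #|A|)).
  by rewrite cards1 card_flat.
have : f x \in flat p q by rewrite -E !inE eqxx.
have : f y \in flat p q by rewrite -E !inE eqxx orbT.
rewrite -(er x) -(er y) !fe !inE.
move=> /orP[/orP[]|] /eqP Ey /orP[/orP[]|] /eqP Ex; move: fxy;
  by rewrite Ex Ey ?eqxx // => _; apply: PC.
Qed.

(** The latin square h corresponds to the blocks with coordinates (a, b, h (a, b)). Unique covering
    of pairs over p and q makes h a function, over p and s a bijection in b, over q and s a
    bijection in a. *)
Lemma card_factor_line : #|[set A | factor f (flat p q) A]| = Lambda c.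
Proof.
apply/esym.
pose g (h : {ffun 'I_c * 'I_c -> 'I_c}) : {set {set T}} :=
  [set tri ab.1 ab.2 (h ab) | ab : 'I_c * 'I_c].
pose g' (A : {set {set T}}) : {ffun 'I_c * 'I_c -> 'I_c} :=
  [ffun ab => odflt ab.1 [pick d | tri ab.1 ab.2 d \in A]].
have gE h a b d : (tri a b d \in g h) = (h (a, b) == d).
  apply/imsetP/eqP => [[[a' b'] _ /= E]|<-]; last by exists (a, b).
  have := mem_p a a b d; rewrite E mem_p eqxx => /eqP Ea.
  have := mem_q a b b d; rewrite E mem_q eqxx => /eqP Eb.
  have := mem_s a b d d; rewrite E mem_s eqxx => /eqP Ed.
  by rewrite Ea Eb Ed.
have gin h b : b \in g h -> exists a' b', b = tri a' b' (h (a', b')).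
  by case/imsetP => -[a' b'] _ ->; exists a', b'.
(* The block covering the pair over p and q supplies a witness for [pick], so on a factor the
   default value is never returned. *)
have g'P A a b : factor f (flat p q) A -> tri a b (g' A (a, b)) \in A.
  move=> /factorP[H1 H2]; rewrite ffunE; case: pickP => //= H.
  have [||bl [blA ab bb _]] := pair_uniqueP _ _ _ (H2 (e p a) (e q b) _ _).
  - by rewrite e_eq (negPf pq).
  - by rewrite !fe.
  have [b3 fb _] := H1 _ blA; have [x [y [z E]]] := block_tri b3 fb.
  move: ab bb; rewrite E mem_p mem_q => /eqP Ex /eqP Ey.
  by have := H z; rewrite Ex Ey -E blA.
apply: (card_bij (g := g) (h := g')).
- move=> h; rewrite !inE => /andP[/forallP L1 /forallP L2].
  apply/factorP; split=> [b /gin[x [y ->]]|x1 x2 _].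
    by rewrite card_tri f_tri flat_in.
  apply: (pair_cases (P := fun y1 y2 => pair_unique (g h) y1 y2)) => [x y|a b|a d|b d];
    first by rewrite pair_uniqueC.
  + apply/pair_uniqueP; exists (tri a b (h (a, b))); rewrite gE mem_p mem_q !eqxx; split=> //.
    by move=> _ /gin[x [y ->]]; rewrite mem_p mem_q => /eqP -> /eqP ->.
  + have inj := injectiveP _ (L1 a).
    (* The block through a over p and d over s is found by solving h (a, b) = d for b. *)
    pose b := invF inj d; have hb : h (a, b) = d by apply: (f_invF inj).
    apply/pair_uniqueP; exists (tri a b d); rewrite gE hb mem_p mem_s !eqxx; split=> //.
    move=> _ /gin[x [y ->]]; rewrite mem_p mem_s => /eqP <- /eqP E.
    by have -> : y = b; [apply: (inj); rewrite hb | rewrite hb].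
  have inj := injectiveP _ (L2 b).
  pose a := invF inj d; have ha : h (a, b) = d by apply: (f_invF inj).
  apply/pair_uniqueP; exists (tri a b d); rewrite gE ha mem_q mem_s !eqxx; split=> //.
  move=> _ /gin[x [y ->]]; rewrite mem_q mem_s => /eqP <- /eqP E.
  by have -> : x = a; [apply: (inj); rewrite ha | rewrite ha].
- move=> A; rewrite inE => FA; have [H1 H2] := factorP _ _ _ FA; rewrite inE.
  apply/andP; split; apply/forallP => x; apply/injectiveP => y y' E.
    have /pair_uniqueP[bl [_ _ _ U]] : pair_unique A (e p x) (e s (g' A (x, y))).
      apply: H2; first by rewrite e_eq (negPf ps).
      rewrite !fe; apply: flat_mem; rewrite ?inE ?eqxx ?orbT //.
    have E1 : tri x y (g' A (x, y)) = bl by apply: U; rewrite ?mem_p ?mem_s ?g'P.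
    have E2 : tri x y' (g' A (x, y')) = bl by apply: U; rewrite ?mem_p ?mem_s ?g'P ?E.
    by have := mem_q x y y (g' A (x, y)); rewrite E1 -E2 mem_q eqxx => /eqP.
  have /pair_uniqueP[bl [_ _ _ U]] : pair_unique A (e q x) (e s (g' A (y, x))).
    apply: H2; first by rewrite e_eq (negPf qs).
    rewrite !fe; apply: flat_mem; rewrite ?inE ?eqxx ?orbT //.
  have E1 : tri y x (g' A (y, x)) = bl by apply: U; rewrite ?mem_q ?mem_s ?g'P.
  have E2 : tri y' x (g' A (y', x)) = bl by apply: U; rewrite ?mem_q ?mem_s ?g'P ?E.
  by have := mem_p y y x (g' A (y, x)); rewrite E1 -E2 mem_p eqxx => /eqP.
- move=> h _; apply/ffunP => -[a b]; rewrite ffunE /=.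
  case: pickP => [d|/(_ (h (a, b)))]; rewrite gE; first by move/eqP.
  by rewrite eqxx.
move=> A; rewrite inE => FA; have [H1 H2] := factorP _ _ _ FA.
apply/setP => b; apply/idP/idP => [/gin[x [y ->]]|bA]; first exact: g'P.
have [b3 fb _] := H1 _ bA; have [x [y [z E]]] := block_tri b3 fb.
have /pair_uniqueP[bl [_ _ _ U]] : pair_unique A (e p x) (e q y).
  by apply: H2; rewrite ?fe // e_eq (negPf pq).
rewrite (U b) ?E ?mem_p ?mem_q // -?E //.
rewrite -(U (tri x y (g' A (x, y)))) ?mem_p ?mem_q ?g'P //.
by rewrite gE.
Qed.

End Line.

(** * The count *)

(** In the product over subsets of V, a non-flat contributes 1, each point [Psi c], and each of the
    #|V| (#|V| - 1) / 6 lines [Lambda c]. *)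
Lemma card_sts_hom (T : finType) (V : finZmodType) (f : T -> V) c :
  (forall p : V, p *+ 3 = 0) -> balanced c f ->
  #|[set B : {set {set T}} | sts_on setT B && hom_sts f B]|
  = (Psi c ^ #|V| * Lambda c ^ ((#|V| * (#|V| - 1)) %/ 6))%N.
Proof.
move=> V3 balf; have [e [eI fe] [r er]] := balanced_param balf.
rewrite card_sts_hom_factor // (bigID [in flats V]) /=.
rewrite [X in (_ * X)%N]big1 ?muln1 => [|y]; last exact: card_factor_notin.
rewrite (bigID (fun y : {set V} => #|y| == 1%N)) /= -(card_line_flats V3) mulnK //.
rewrite -(card_point_flats V3) -!prod_nat_const; congr (_ * _)%N.
  apply: eq_big => [y|y /andP[_ /cards1P[p ->]]]; first by rewrite inE.
  rewrite -(card_sts_on (eI p)); apply: eq_card => A; rewrite !inE factor_point //.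
  congr (sts_on _ _); apply/setP => x; rewrite inE.
  apply/eqP/imsetP => [<-|[a _ ->]]; last exact: fe.
  by exists (r x); rewrite ?er.
apply: eq_big => [y|_ /andP[/imsetP[[p q] _ ->]]]; first by rewrite inE.
have [->|pq _] := eqVneq p q; first by rewrite flatxx // cards1.
exact: (card_factor_line V3 eI fe er pq).
Qed.

(** Double count of pairs (B, Y) with Y balanced and compatible with B. For fixed B, balanced and
    spanning agree on compatible Y; for fixed Y, [card_sts_hom] applies. The factor c!^(3^j) turns
    the number of balanced Y into v!. *)
Lemma sum_nb_ext v j : (0 < v)%N -> (3 ^ j %| v)%N ->
  (\sum_(B : {set {set 'I_v}} | is_STS B) nb_ext (v - rank3 B - 1) j
     * (v %/ 3 ^ j)`! ^ (3 ^ j))%N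
  = (v`! * (Psi (v %/ 3 ^ j) ^ (3 ^ j)
     * Lambda (v %/ 3 ^ j) ^ ((3 ^ j * (3 ^ j - 1)) %/ 6)))%N.
Proof.
move=> v0 dv; set c := (v %/ 3 ^ j)%N.
have c0 : (0 < c)%N by rewrite divn_gt0 ?expn_gt0 // dvdn_leq.
have cV : #|{: 'cV['F_3]_j}| = (3 ^ j)%N by rewrite card_mx card_Fp // muln1.
have cT : #|'I_v| = (#|{: 'cV['F_3]_j}| * c)%N by rewrite card_ord cV mulnC divnK.
have cbal : (#|[set Y : 'M['F_3]_(j, v) | balanced c (fun x => col x Y)]| * c`! ^ (3 ^ j) = v`!)%N.
  have := card_balanced cT; rewrite card_ord cV => <-; congr (_ * _)%N.
  apply: (card_bij (g := fun Y : 'M['F_3]_(j, v) => [ffun x => col x Y])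
    (h := fun f : {ffun 'I_v -> 'cV['F_3]_j} => \matrix_(i, x) f x i 0)).
  - move=> Y; rewrite !inE => /forallP H; apply/forallP => p; rewrite -(eqP (H p)).
    by apply/eqP/eq_card => x; rewrite !inE ffunE.
  - move=> f; rewrite !inE => /forallP H; apply/forallP => p; rewrite -(eqP (H p)).
    apply/eqP/eq_card => x; rewrite !inE; congr (_ == _).
    by apply/matrixP => i k; rewrite !mxE (ord1 k).
  - by move=> Y _; apply/matrixP => i x; rewrite mxE ffunE mxE.
  move=> f _; apply/ffunP => x; rewrite ffunE.
  by apply/matrixP => i k; rewrite !mxE (ord1 k).
rewrite -big_distrl /= -cbal mulnAC; congr (_ * _)%N.
rewrite -sum_nat_const.
transitivity (\sum_(B : {set {set 'I_v}} | is_STS B)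
   \sum_(Y : 'M['F_3]_(j, v) | balanced c (fun x => col x Y))
     hom_sts (fun x => col x Y) B)%N.
  apply: eq_bigr => B; rewrite is_STSE => stsB.
  rewrite -(card_hom_spanning _ v0 stsB) -sum1dep_card big_mkcond [RHS]big_mkcond /=.
  apply: eq_bigr => Y _; case: (boolP (hom_sts _ B)) => homY /=; last by rewrite if_same.
  suff -> : spanning Y = balanced c (fun x => col x Y) by [].
  apply/idP/idP => [spY|]; last exact: balanced_spanning.
  by have [] := hom_spanning_balanced v0 stsB homY spY.
rewrite exchange_big /=; apply: eq_big => [Y|Y balY]; first by rewrite inE.
rewrite -cV -(card_sts_hom (@mulr3n_F3 j 1) balY) -sum1dep_card.
rewrite big_mkcond [RHS]big_mkcond; apply: eq_bigr => B _.
by rewrite is_STSE; case: (sts_on _ B); case: (hom_sts _ B).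
Qed.

(** For this m all factors of [nb_ext m m] are positive, so a compatible spanning map to GF(3)^m
    exists, and its equal fibers make 3^m divide v. *)
Lemma corank_le_logn v (B : {set {set 'I_v}}) : (0 < v)%N -> sts_on setT B ->
  (v - rank3 B - 1 <= logn 3 v)%N.
Proof.
move=> v0 stsB; set m := (v - rank3 B - 1)%N.
have : (0 < nb_ext m m)%N.
  rewrite prodn_gt0 // => s; rewrite subn_gt0 ltn_exp2l //.
  by rewrite add1n ltnS.
rewrite -(card_hom_spanning m v0 stsB) => /card_gt0P[Y]; rewrite inE => /andP[homY spY].
by rewrite -pfactor_dvdn //; have [] := hom_spanning_balanced v0 stsB homY spY.
Qed.

Theorem theorem1 (v i : nat) :
  (v %% 6 = 1 \/ v %% 6 = 3)%N ->
  (i <= logn 3 v)%N ->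
  (#|[set B : {set {set 'I_v}} | is_STS B && (rank3 B == (v - i - 1)%N)]|)%:R
  = Gamma v 0 i *
    \sum_(i <= j < (logn 3 v).+1) Gamma v i j * mu3 (j - i) * Phi v j :> rat.
Proof.
move=> v6 ik.
have v0 : (0 < v)%N by case: v v6 {ik} => // -[].
have iv : (i < v)%N.
  by apply: leq_trans (ltn_expl i (isT : 1 < 3)%N) _; rewrite dvdn_leq // pfactor_dvdn.
rewrite mulr_sumr; pose k := logn 3 v.
(* The indicator of rank v - i - 1 is expanded through [inv_coef], so that the sums over B and j can
   be exchanged. *)
transitivity (\sum_(B : {set {set 'I_v}} | is_STS B)
   \sum_(i <= j < k.+1) inv_coef i j * (nb_ext (v - rank3 B - 1) j)%:R).
  rewrite -sum1dep_card natr_sum big_mkcondr /=.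
  apply: eq_bigr => B; rewrite is_STSE => stsB.
  rewrite inv_coef_nb_ext ?corank_le_logn //.
  have rB := rank3_lt v0 stsB.
  (* Truncated subtraction is harmless: both i and the rank are below v. *)
  have -> : (rank3 B == v - i - 1)%N = (v - rank3 B - 1 == i)%N by lia.
  by case: eqP.
rewrite exchange_big /=; apply: eq_big_nat => j /andP[ij jk].
rewrite -mulr_sumr.
transitivity (Gamma v 0 i * Gamma v i j * mu3 (j - i) * Phi v j); last by ring.
rewrite inv_coefE // -mulrA; congr (_ * _).
have dv : (3 ^ j %| v)%N by rewrite pfactor_dvdn.
have := congr1 (fun n => n%:R : rat) (sum_nb_ext v0 dv).
rewrite -big_distrl /= !natrM !natrX natr_sum => E.
have nz : ((v %/ 3 ^ j)`!)%:R ^+ (3 ^ j) != 0 :> rat.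
  by rewrite expf_neq0 // pnatr_eq0 -lt0n fact_gt0.
by apply: (mulIf nz); rewrite E /Phi mulrAC divfK.
Qed.
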